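(* Let $X$ be a discretely dense subspace of the Tychonoff product $\prod_{\alpha\in A}X_\alpha$ of topological spaces. If all spaces $X_\alpha$, $\alpha\in A$, are super, then so is the space $X$.
   Context: A family $\mathcal N$ of subsets of a topological space $X$ is called: a $k$-network if for any open set $U\subset X$ and any compact set $K\subset U$ there exists a finite subfamily $\mathcal F\subset\mathcal N$ such that $K\subset\bigcup\mathcal F\subset U$; a closed $k$-network if it is a $k$-network and each $N\in\mathcal N$ is closed in $X$; linked if $A\cap B\neq\emptyset$ for any $A,B\in\mathcal N$; centered if $\bigcap\mathcal F\ne\emptyset$ for every finite nonempty subfamily $\mathcal F\subset\mathcal N$; binary if every linked subfamily of $\mathcal N$ is centered. A topological space is super if it possesses a binary closed $k$-network. A subset $X$ of a product $\prod_{\alpha\in A}X_\alpha$ is discretely dense if for any $x\in\prod_{\alpha\in A}X_\alpha$ and any finite set $F\subset A$ there exists $y\in X$ such that $y{\restriction}_F=x{\restriction}_F$ (equivalently, $X$ is dense in the Tychonoff product of the sets $X_\alpha$ endowed with discrete topologies). $X$ carries the subspace topology inherited from the Tychonoff product topology.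
   Formalization: All the spaces X_α are additionally assumed to be Hausdorff; for arbitrary topological spaces the claim fails, since there is a compact T1 non-Hausdorff super space whose square has a compact non-closed diagonal and so is not super. *)

(* Defs.v *)
From HB Require Import structures.
From mathcomp Require Import all_boot all_order all_algebra.
From mathcomp Require Import all_classical all_reals all_analysis.

Set Implicit Arguments.
Unset Strict Implicit.
Unset Printing Implicit Defensive.

Local Open Scope classical_set_scope.

Section families.
Context {X : Type}.
Implicit Types N : set (set X).

Definition linked N := forall A B, N A -> N B -> A `&` B !=set0.

Definition centered N := forall F : set (set X),
  finite_set F -> F !=set0 -> F `<=` N -> \bigcap_(B in F) B !=set0.

Definition binary N := forall M : set (set X),
  M `<=` N -> linked M -> centered M.

End families.

Definition k_network (X : topologicalType) (N : set (set X)) :=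
  forall U K : set X, open U -> compact K -> K `<=` U ->
  exists F : set (set X), [/\ finite_set F, F `<=` N,
    K `<=` \bigcup_(B in F) B & \bigcup_(B in F) B `<=` U].

Definition closed_k_network (X : topologicalType) (N : set (set X)) :=
  k_network N /\ forall B, N B -> closed B.

Definition super (X : topologicalType) :=
  exists N : set (set X), closed_k_network N /\ binary N.

Definition discretely_dense (A : Type) (T : A -> Type)
    (X : set (forall a, T a)) :=
  forall (x : forall a, T a) (F : set A), finite_set F ->
  exists2 y, X y & forall a, F a -> y a = x a.

(* Main.v *)
Require Import Defs.
From mathcomp Require Import all_boot all_order all_algebra.
From mathcomp Require Import all_classical all_reals all_analysis.

(** The witness for [X] consists of the finite intersections of the traces on
    [X] of the cylinders over members of the given binary closed k-networks.

    Binarity is combinatorial. A linked family of cylinders projects, in each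
    coordinate, to a linked family, which is centered there; prescribing a
    common point in the finitely many coordinates involved is exactly what
    discrete density allows ([binary_cylinders]). Passing to finite
    intersections preserves binarity ([binary_finI]), because a linked family
    of intersections spreads out into a linked family of factors.

    The k-network property is local ([compact_local_ind]): it is enough to
    approximate [K `&` V] inside [U] for some neighbourhood [V] of each point
    [x] of [K]. For fixed [K] and [x], the sets [U] for which such a [V] exists
    form a filter, as the family of finite intersections is closed under binary
    intersections; so it converges to [x] as soon as it contains the cylinders
    over neighbourhoods of the coordinates of [x] ([k_network_cylinders]). For a
    cylinder, regularity of the compact Hausdorff set [K]
    ([compact_relative_regular]) gives a [V] whose closure meets [K] inside the
    cylinder, and the k-network of that coordinate applies to the compact
    projection of [K `&` closure V]. *)

Local Open Scope classical_set_scope.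

(** * Finite intersections and cylinders *)

Definition finI {X : Type} (S : set (set X)) : set (set X) :=
  [set C | exists F, [/\ finite_set F, F `<=` S & C = \bigcap_(B in F) B]].

Definition cylinders {X A : Type} {T : A -> Type} (f : forall a, X -> T a)
    (N : forall a, set (set (T a))) : set (set X) :=
  [set C | exists a, exists2 D, N a D & C = f a @^-1` D].

Section finite_intersections.
Context {X : Type}.
Implicit Types (S : set (set X)) (B C : set X).

Lemma finI_setT S : finI S setT.
Proof.
by exists set0; split; [exact: finite_set0|exact: sub0set|rewrite bigcap_set0].
Qed.

Lemma sub_finI S : S `<=` finI S.
Proof.
move=> B SB; exists [set B]; split; first exact: finite_set1.
- by move=> _ ->.
- by rewrite bigcap_set1.
Qed.

Lemma finI_setI S B C : finI S B -> finI S C -> finI S (B `&` C).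
Proof.
move=> [F [finF FS ->]] [G [finG GS ->]]; exists (F `|` G); split.
- by rewrite finite_setU.
- by rewrite subUset.
- by rewrite bigcap_setU.
Qed.

(** A linked family of finite intersections has linked factors, since two
    factors contain the intersections they come from. *)
Lemma binary_finI S : binary S -> binary (finI S).
Proof.
move=> binS M MS lM F finF [C0 FC0] FM.
have [D DP] : {D : set X -> set (set X) & forall C, F C ->
    [/\ finite_set (D C), D C `<=` S & C = \bigcap_(B in D C) B]}.
  apply: (@choice _ _ (fun C E => F C ->
    [/\ finite_set E, E `<=` S & C = \bigcap_(B in E) B])) => C.
  have [FC|nFC] := pselect (F C); last by exists set0 => /nFC.
  by have [E EP] := MS _ (FM _ FC); exists E.
pose G := \bigcup_(C in F) D C.
have GS : G `<=` S by move=> B [C FC]; have [_ + _] := DP _ FC; apply.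
have lG : linked G.
  move=> B B' [C FC DB] [C' FC' DB'].
  have [x []] := lM _ _ (FM _ FC) (FM _ FC').
  have [_ _ ->] := DP _ FC; have [_ _ ->] := DP _ FC'.
  by move=> Cx C'x; exists x; split; [exact: Cx|exact: C'x].
have finG : finite_set G by apply: bigcup_finite => // C /DP[].
suff [x Gx] : exists x, forall B, G B -> B x.
  exists x => C FC; have [_ _ ->] := DP _ FC.
  by move=> B DB; apply: Gx; exists C.
have [G0|nG] := pselect (G !=set0).
  by have [x Gx] := binS G GS lG G finG G0 (fun _ => id); exists x.
(* Without factors every member of F is the whole space: any point will do. *)
have [x _] := lM _ _ (FM _ FC0) (FM _ FC0).
by exists x => B GB; case: nG; exists B.
Qed.

End finite_intersections.

(** The hypothesis [densef] only prescribes finitely many coordinates at once,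
    which suffices: a finite family of cylinders involves finitely many. *)
Lemma binary_cylinders {X A : Type} {T : A -> Type} (f : forall a, X -> T a)
    (N : forall a, set (set (T a)))
    (densef : forall (t : forall a, T a) (E : set A), finite_set E ->
      exists y, forall a, E a -> f a y = t a) :
  (forall a, binary (N a)) -> binary (cylinders f N).
Proof.
move=> binN M MS lM F finF [C0 FC0] FM.
have [x0 _] := lM _ _ (FM _ FC0) (FM _ FC0).
(* The base is chosen once for each cylinder and coordinate, so that a finite
   family of cylinders has finitely many bases even if [f a] is not onto. *)
pose is_base a C := [set D | N a D /\ C = f a @^-1` D].
pose base a C := xget set0 (is_base a C).
have baseP a C : is_base a C !=set0 -> is_base a C (base a C).
  by move=> [D CD]; exact: (xgetPex set0 (ex_intro _ D CD)).
pose N' a := base a @` (F `&` [set C | is_base a C !=set0]).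
have N't a : exists t, forall D, N' a D -> D t.
  have [N'0|nN'] := pselect (N' a !=set0); last first.
    by exists (f a x0) => D N'D; case: nN'; exists D.
  have N'N : N' a `<=` N a by move=> _ [C [_ /baseP[]] + _ <-].
  have lN' : linked (N' a).
    move=> _ _ [C [FC /baseP[_ eC]] <-] [C' [FC' /baseP[_ eC']] <-].
    have [y [Cy C'y]] := lM _ _ (FM _ FC) (FM _ FC').
    by exists (f a y); split; [rewrite eC in Cy|rewrite eC' in C'y].
  have finN' : finite_set (N' a).
    by apply: finite_image; exact: finite_setIl.
  by have [t tP] := binN a _ N'N lN' _ finN' N'0 (fun _ => id); exists t.
pose t a := sval (cid (N't a)).
have tP a D : N' a D -> D (t a) := svalP (cid (N't a)) D.
have [a0 _] := MS _ (FM _ FC0).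
have [idx idxP] : {idx : set X -> A & forall C, F C ->
    is_base (idx C) C !=set0}.
  apply: (@choice _ _ (fun C a => F C -> is_base a C !=set0)) => C.
  have [FC|nFC] := pselect (F C); last by exists a0 => /nFC.
  by have [a [D ND CD]] := MS _ (FM _ FC); exists a => _; exists D.
have [y yP] := densef t (idx @` F) (finite_image _ finF).
exists y => C FC; have [_ ->] := baseP _ _ (idxP _ FC).
rewrite /preimage /= yP; last by exists C.
by apply: tP; exists C => //; split=> //; exact: idxP.
Qed.

(** * Compact sets *)

(** Otherwise the sets [Q] such that [P (K `\` Q)] form a proper filter on [K],
    which cannot cluster at any point of [K]. *)
Lemma compact_local_ind {X : topologicalType} (K : set X)
    (P : set X -> Prop) :
  compact K -> P set0 -> (forall L M, L `<=` M -> P M -> P L) ->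
  (forall L M, P L -> P M -> P (L `|` M)) ->
  (forall x, K x -> exists2 V, nbhs x V & P (K `&` V)) -> P K.
Proof.
move=> cK P0 PS PU locP; apply: contrapT => nPK.
pose G : set_system X := [set Q | P (K `\` Q)].
have FG : ProperFilter G.
  split; first by rewrite /G /= setD0.
  split.
  - by rewrite /G /= setDT.
  - by move=> Q R GQ GR; rewrite /G /= setDIr; exact: PU.
  - by move=> Q R QR; apply: PS; exact: setDS.
have [|x [Kx clGx]] := cK G FG; first by rewrite /G /= setDv.
have [V xV PV] := locP _ Kx.
have GV : G (~` V) by rewrite /G /= setDE setCK.
by have [y []] := clGx _ _ GV xV.
Qed.

(** [K] as a space of its own is regular: near a point [y] of [K], either [y] is
    in [U] and nothing is needed, or [y <> x] and these two are separated. *)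
Lemma compact_relative_regular {X : topologicalType} (K U : set X) (x : X) :
  hausdorff_space X -> compact K -> nbhs x U ->
  exists2 V, nbhs x V & K `&` closure V `<=` U.
Proof.
move=> hX cK /nbhs_interior xU.
pose P L := exists2 V, nbhs x V & L `&` closure V `<=` U.
apply: (@compact_local_ind X K P) => //.
- by exists setT; [exact: filterT|rewrite set0I].
- move=> L M LM [V xV MV]; exists V => //.
  by apply: subset_trans MV; exact: setSI.
- move=> L M [V xV LV] [W xW MW]; exists (V `&` W); first exact: filterI.
  by move=> y [[Ly|My] /closureI[Vy Wy]]; [exact: LV|exact: MW].
- move=> y Ky; have [yU|nyU] := pselect (nbhs y U).
    exists U => //; exists setT; first exact: filterT.
    by move=> z [[]].
  have : ~ cluster (nbhs x) y.
    by move=> /hX xy; apply: nyU; rewrite -xy; exact: nbhs_singleton xU.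
  move=> /existsNP[V /existsNP[W /not_implyP[xV /not_implyP[yW VW]]]].
  exists (interior W); first exact: nbhs_interior.
  by exists V => // z [[_ Wz] /(_ _ Wz)].
Qed.

(** * The k-network property *)

Definition approximable {X : Type} (N : set (set X)) (K U : set X) :=
  exists F : set (set X), [/\ finite_set F, F `<=` N,
    K `<=` \bigcup_(B in F) B & \bigcup_(B in F) B `<=` U].

Section approximable.
Context {X : Type}.
Implicit Types (N S : set (set X)) (K L U V : set X).

Lemma approximable0 N U : approximable N set0 U.
Proof.
by exists set0; split; [exact: finite_set0|exact: sub0set|exact: sub0set
  |rewrite bigcup_set0; exact: sub0set].
Qed.

Lemma approximable_sub N K L U V :
  L `<=` K -> U `<=` V -> approximable N K U -> approximable N L V.
Proof.
move=> LK UV [F [finF FN KF FU]]; exists F; split => //.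
- exact: subset_trans KF.
- exact: subset_trans UV.
Qed.

Lemma approximableU N K L U :
  approximable N K U -> approximable N L U -> approximable N (K `|` L) U.
Proof.
move=> [F [finF FN KF FU]] [G [finG GN LG GU]]; exists (F `|` G).
rewrite bigcup_setU finite_setU; split=> //.
- by rewrite subUset.
- exact: setUSS.
- by rewrite subUset.
Qed.

Lemma approximable_setT S K : approximable (finI S) K setT.
Proof.
exists [set setT]; rewrite bigcup_set1.
by split=> // _ ->; exact: finI_setT.
Qed.

Lemma approximableI S K U V : approximable (finI S) K U ->
  approximable (finI S) K V -> approximable (finI S) K (U `&` V).
Proof.
move=> [F [finF FS KF FU]] [G [finG GS KG GV]].
exists [set B `&` C | B in F & C in G]; split.
- exact: finite_image2.
- by move=> _ [B FB [C GC <-]]; apply: finI_setI; [exact: FS|exact: GS].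
- move=> x Kx; have [B FB Bx] := KF _ Kx; have [C GC Cx] := KG _ Kx.
  by exists (B `&` C) => //; exists B => //; exists C.
- move=> x [_ [B FB [C GC <-]] [Bx Cx]].
  by split; [apply: FU; exists B|apply: GV; exists C].
Qed.

End approximable.

(** That [X] carries the initial topology of the [f a] enters through its
    universal property for filters, [initf]. Hausdorffness provides the compact
    pieces of [K] that project into the neighbourhoods of the factors. *)
Lemma k_network_cylinders {X : topologicalType} {A : Type}
    {T : A -> topologicalType} (f : forall a, X -> T a)
    (N : forall a, set (set (T a)))
    (contf : forall a, continuous (f a))
    (initf : forall (G : set_system X) x, Filter G ->
      (forall a, f a @ G --> f a x) -> G --> x) :
  hausdorff_space X -> (forall a, k_network (N a)) ->
  k_network (finI (cylinders f N)).
Proof.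
move=> hX netN U K oU cK KU; pose S := cylinders f N.
apply: (@compact_local_ind X K (fun L => approximable (finI S) L U)) => //.
- exact: approximable0.
- by move=> L M LM; exact: approximable_sub.
- by move=> L M; exact: approximableU.
move=> x Kx.
pose G : set_system X :=
  [set Q | exists2 V, nbhs x V & approximable (finI S) (K `&` V) Q].
have FG : Filter G.
  split.
  - by exists setT; [exact: filterT|exact: approximable_setT].
  - move=> Q R [V xV QV] [W xW RW]; exists (V `&` W); first exact: filterI.
    apply: approximableI.
    + by apply: approximable_sub QV => //; apply: setIS; exact: subIsetl.
    + by apply: approximable_sub RW => //; apply: setIS; exact: subIsetr.
  - by move=> Q R QR [V xV QV]; exists V => //; exact: approximable_sub QV.
suff GU : G --> x by apply: GU; apply: open_nbhs_nbhs; split=> //; exact: KU.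
apply: initf => a W /nbhs_interior; rewrite nbhsE => -[Q [oQ Qx] QW].
have xQ : nbhs x (f a @^-1` Q) by apply: contf; exact: open_nbhs_nbhs.
have [V xV KV] := @compact_relative_regular X K _ x hX cK xQ.
exists V => //.
have cL : compact (f a @` (K `&` closure V)).
  apply: continuous_compact; first exact/continuous_subspaceT/contf.
  by apply: compact_closedI => //; exact: closed_closure.
have [|F [finF FN LF FQ]] := netN a Q _ oQ cL.
  by move=> _ [z /KV Qz <-].
exists ((fun D => f a @^-1` D) @` F); split.
- exact: finite_image.
- by move=> _ [D FD <-]; apply: sub_finI; exists a, D => //; exact: FN.
- move=> z [Kz Vz].
  have [|D FD Dz] := LF (f a z).
    by exists z => //; split=> //; exact: subset_closure.
  by exists (f a @^-1` D) => //; exists D.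
- move=> z [_ [D FD <-] Dz].
  by have /QW/interior_subset : Q (f a z) by apply: FQ; exists D.
Qed.

Lemma closed_finI_cylinders {X : topologicalType} {A : Type}
    {T : A -> topologicalType} (f : forall a, X -> T a)
    (N : forall a, set (set (T a))) :
  (forall a, continuous (f a)) -> (forall a D, N a D -> closed D) ->
  forall C, finI (cylinders f N) C -> closed C.
Proof.
move=> contf clN C [F [_ FS ->]]; apply: closed_bigI => B /FS[a [D ND ->]].
by apply: preimage_closed (clN _ _ ND) => x _; exact: contf.
Qed.

Lemma hausdorff_separating_maps {X : topologicalType} {A : Type}
    {T : A -> topologicalType} (f : forall a, X -> T a) :
  (forall a, continuous (f a)) -> (forall a, hausdorff_space (T a)) ->
  (forall x y, (forall a, f a x = f a y) -> x = y) -> hausdorff_space X.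
Proof.
move=> contf hT sepf x y clxy; apply: sepf => a; apply: hT => V W xV yW.
have [z [Vz Wz]] := clxy _ _ (contf a _ _ xV) (contf a _ _ yW).
by exists (f a z).
Qed.

(** * Subspaces of products *)

Section coordinates.
Context {A : Type} {T : A -> topologicalType} (X : set (prod_topology T)).

Definition coordinate (a : A) (x : set_type X) : T a := set_val x a.

Lemma coordinate_continuous a : continuous (coordinate a).
Proof.
move=> x; apply: (@continuous_comp _ _ _ (set_val : set_type X -> _)
  (fun y : prod_topology T => y a)); first exact: initial_continuous.
exact: (@proj_continuous {classic A} T a).
Qed.

Lemma coordinate_initial (G : set_system (set_type X)) x : Filter G ->
  (forall a, coordinate a @ G --> coordinate a x) -> G --> x.
Proof.
move=> FG cvgG W [_ [[Q oQ <-] Qx] /filterS]; apply.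
have : set_val @ G --> (set_val x : prod_topology T); last first.
  by apply; exact: open_nbhs_nbhs.
apply/cvg_sup => a W' [_ [[B oB <-] Bx] /filterS]; apply.
by apply: (cvgG a); exact: open_nbhs_nbhs.
Qed.

End coordinates.

(* [prod_topology T] is the Tychonoff product, and [set_type X] carries the
   subspace topology. Spaces are Hausdorff by convention: over arbitrary
   topological spaces the assertion is false. *)
Theorem theorem4 (A : Type) (T : A -> topologicalType)
    (X : set (prod_topology T))
    (hausdorffT : forall a, hausdorff_space (T a))
    (denseX : discretely_dense X)
    (superT : forall a, super (T a)) :
  super (set_type X).
Proof.
pose N a := sval (cid (superT a)).
have NP a : closed_k_network (N a) /\ binary (N a) := svalP (cid (superT a)).
have contX := @coordinate_continuous A T X.
exists (finI (cylinders (@coordinate A T X) N)); split; first split.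
- apply: k_network_cylinders => //; first exact: coordinate_initial.
    apply: hausdorff_separating_maps contX hausdorffT _ => x y xy.
    by apply: val_inj; apply: functional_extensionality_dep => a; exact: xy.
  by move=> a; have [[]] := NP a.
- by apply: closed_finI_cylinders => // a; have [[]] := NP a.
- apply/binary_finI/binary_cylinders => [t E finE|a]; last by have [] := NP a.
  have [y Xy yt] := denseX t E finE.
  by exists (SigSub (mem_set Xy)).
Qed.
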